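(* Let $a$ and $d$ be integers with $a\ge 3$, $d>0$ and $\gcd(a,d)=1$, and let $A_3=\{a,a+d,a+2d\}$. For a nonnegative integer $n$ let $d(n;A_3)$ be the number of triples $(x_1,x_2,x_3)$ of nonnegative integers with $a x_1+(a+d)x_2+(a+2d)x_3=n$. For an integer $p\ge 0$ let $g_p(A_3)$ be the largest integer $n$ with $d(n;A_3)\le p$, and let $n_p(A_3)$ be the number of nonnegative integers $n$ with $d(n;A_3)\le p$. Then for every integer $p$ with $0\le p\le\lfloor a/2\rfloor$, $$g_p(a,a+d,a+2d)=(a+2d)p+\left\lfloor\frac{a-2}{2}\right\rfloor a+(a-1)d,$$ and $$n_p(a,a+d,a+2d)=\begin{cases}(2a+2d-1-p)p+\dfrac{(a-1)(a+2d-1)}{4}&\text{if $a$ is odd},\\[2mm] (2a+2d-1-p)p+\dfrac{(a-1)(a+2d-1)+1}{4}&\text{if $a$ is even}.\end{cases}$$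
   Context: $g_p$ is the $p$-Frobenius number (for $p=0$ the classical Frobenius number); $n_p$ is the $p$-genus (generalized Sylvester number). Both are finite since $\gcd(a,a+d,a+2d)=1$. *)

(* Defs.v *)
From mathcomp Require Import all_boot all_order all_algebra.
From mathcomp Require Import finmap.
From mathcomp Require Import boolp classical_sets functions cardinality.

Set Implicit Arguments.
Unset Strict Implicit.
Unset Printing Implicit Defensive.

Local Open Scope classical_set_scope.
Local Open Scope fset_scope.
Local Open Scope nat_scope.

Definition representations (a1 a2 a3 n : nat) : set (nat * nat * nat) :=
  [set x | a1 * x.1.1 + a2 * x.1.2 + a3 * x.2 = n].

Lemma finite_representations (a1 a2 a3 n : nat) :
  0 < a1 -> 0 < a2 -> 0 < a3 -> finite_set (representations a1 a2 a3 n).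
Proof.
move=> a1_gt0 a2_gt0 a3_gt0.
apply: (@sub_finite_set _ _ ((`I_n.+1 `*` `I_n.+1) `*` `I_n.+1)); last first.
  by do ?apply: finite_setX; exact: finite_II.
move=> [[x1 x2] x3] /= xn; rewrite !ltnS -xn.
split; first split.
- by rewrite -addnA (leq_trans (leq_pmull x1 a1_gt0)) ?leq_addr.
- by rewrite addnAC (leq_trans (leq_pmull x2 a2_gt0)) ?leq_addl.
- by rewrite (leq_trans (leq_pmull x3 a3_gt0)) ?leq_addl.
Qed.

(* [fset_set] sends an infinite set to [fset0]; by [finite_representations]
   this does not occur when the generators are positive. *)
Definition denumerant (a1 a2 a3 n : nat) : nat :=
  #|` fset_set (representations a1 a2 a3 n)|.

Definition sparse_set (p a1 a2 a3 : nat) : set nat :=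
  [set n | denumerant a1 a2 a3 n <= p].

(* The next two definitions have their intended meaning only when
   [sparse_set p a1 a2 a3] is finite and, for the first one, nonempty. *)
Definition p_frobenius (p a1 a2 a3 : nat) : nat :=
  \max_(n <- fset_set (sparse_set p a1 a2 a3)) n.

Definition p_genus (p a1 a2 a3 : nat) : nat :=
  #|` fset_set (sparse_set p a1 a2 a3)|.

(* Main.v *)
(** With [s = x1 + x2 + x3] and [t = x2 + 2 * x3], the represented number is
    [a * s + d * t], and [(s, t)] comes from
    [t./2 - max (0, t - s) + 1] triples when [0 <= t <= 2 * s], from none
    otherwise. Fix a residue class modulo [a], that of [d * r] with [r < a].
    For [n = a * m + d * r] the possible pairs are
    [(s, t) = (m - d * k, r + a * k)], and for [p <= a %/ 2] only [k = 0] and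
    [k = 1] matter in deciding whether there are more than [p] triples: this
    happens exactly when [n] reaches a threshold [T r] of the class. Hence
    [g_p] is the maximum of [T r - a], attained at [r = 2 * p - 1] (at
    [r = a - 1] if [p = 0]), and [n_p] is the sum of the [T r %/ a]. *)

Require Import Defs.
From mathcomp Require Import all_boot all_order all_algebra.
From mathcomp Require Import finmap.
From mathcomp Require Import boolp classical_sets functions cardinality.
From mathcomp Require Import zify ring lra.

Local Open Scope nat_scope.

(** * Multiplication by [d] on residues modulo [a] *)

Lemma eqn_modMl_coprime (a d t r : nat) :
  coprime a d -> d * t = d * r %[mod a] -> t = r %[mod a].
Proof.
move=> co_ad; wlog le_rt : t r / r <= t => [wlog_le | ].
  by case: (leqP r t) => [|/ltnW] le_rt eq_dtr; [|apply/esym]; apply: wlog_le.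
move/eqP; rewrite eqn_mod_dvd ?leq_mul2l ?le_rt ?orbT // -mulnBr Gauss_dvdr //.
by rewrite -eqn_mod_dvd // => /eqP.
Qed.

Lemma modn_mul_inj (a d : nat) (a_gt0 : 0 < a) : coprime a d ->
  injective (fun r : 'I_a => Ordinal (ltn_pmod (d * r) a_gt0)).
Proof.
move=> co_ad r1 r2 /(congr1 val) /= /(eqn_modMl_coprime _ _ _ _ co_ad).
by rewrite !modn_small // => /val_inj.
Qed.

Lemma modn_mul_surj (a d n : nat) : 0 < a -> coprime a d ->
  exists2 r, r < a & n = d * r %[mod a].
Proof.
move=> a_gt0 co_ad; have [f _ fK] := injF_bij (modn_mul_inj a d a_gt0 co_ad).
exists (f (Ordinal (ltn_pmod n a_gt0))) => //.
exact: esym (congr1 val (fK (Ordinal (ltn_pmod n a_gt0)))).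
Qed.

(** * Bounding the denumerant by injections *)

Lemma leq_denumerant (a1 a2 a3 n k : nat) (f : nat -> nat * nat * nat) :
    0 < a1 -> 0 < a2 -> 0 < a3 -> {in gtn k &, injective f} ->
    (forall i, i < k -> representations a1 a2 a3 n (f i)) ->
  k <= denumerant a1 a2 a3 n.
Proof.
move=> a1_gt0 a2_gt0 a3_gt0 f_inj f_rep.
have fin := finite_representations n a1_gt0 a2_gt0 a3_gt0.
rewrite /denumerant -[leqLHS](size_iota 0) -(size_map f); apply: uniq_leq_size.
  rewrite map_inj_in_uniq ?iota_uniq // => i j.
  by rewrite !mem_iota; apply: f_inj.
move=> _ /mapP[i ik ->]; rewrite in_fset_set // inE; apply: f_rep.
by rewrite mem_iota in ik.
Qed.

Lemma denumerant_leq (a1 a2 a3 n k : nat) (g : nat * nat * nat -> nat) :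
    0 < a1 -> 0 < a2 -> 0 < a3 ->
    (forall x, representations a1 a2 a3 n x -> g x < k) ->
    (forall x y, representations a1 a2 a3 n x -> representations a1 a2 a3 n y ->
       g x = g y -> x = y) ->
  denumerant a1 a2 a3 n <= k.
Proof.
move=> a1_gt0 a2_gt0 a3_gt0 g_lt g_inj.
have fin := finite_representations n a1_gt0 a2_gt0 a3_gt0.
rewrite /denumerant -[leqRHS](size_iota 0) -(size_map g); apply: uniq_leq_size.
  rewrite map_inj_in_uniq ?fset_uniq // => x y.
  by rewrite !in_fset_set // !inE; apply: g_inj.
move=> _ /mapP[x + ->]; rewrite in_fset_set // inE mem_iota; apply: g_lt.
Qed.

(** * The threshold of a residue class *)

(* The least [m] for which [a * m + d * r] has more than [p] representations:
   [k = 0] contributes [m - uphalf r + 1] of them, up to at most [r./2 + 1],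
   and beyond that [k = 1] contributes [m - d - uphalf (r + a) + 1]. *)
Definition level (a d p r : nat) : nat :=
  if p <= r./2 then uphalf r + p else d + uphalf (r + a) + p - r./2.+1.

Definition threshold (a d p r : nat) : nat := a * level a d p r + d * r.

Lemma threshold_mod (a d p r : nat) : threshold a d p r = d * r %[mod a].
Proof. by rewrite /threshold [a * _]mulnC modnMDl. Qed.

Lemma denumerant_above_threshold (a d p r m : nat) :
  0 < a -> r < a -> p <= a %/ 2 -> level a d p r <= m ->
  p < denumerant a (a + d) (a + 2 * d) (a * m + d * r).
Proof.
move=> a_gt0 r_lt p_le; rewrite /level => m_ge.
(* For fixed [k] the representations are indexed by [x2./2]. *)
pose rep k i := (m - d * k - uphalf (r + a * k) - i,
                 i.*2 + odd (r + a * k), (r + a * k)./2 - i).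
pose f i := if i <= r./2 then rep 0 i else rep 1 (i - r./2.+1).
apply: (@leq_denumerant _ _ _ _ _ f); try lia.
- move=> i j; rewrite !inE /f /rep => ip jp.
  (* [x2 + 2 * x3] is [r] for [k = 0] and [r + a] for [k = 1], so the last two coordinates determine
     [k], then [i]. *)
  move=> eq_f; move: (congr1 (fun x => x.1.2) eq_f) (congr1 snd eq_f) m_ge.
  by case: (leqP i) => ir; case: (leqP j) => jr /=; case: ifP; lia.
- move=> i ip; rewrite /representations /f /rep /=.
  have E k j : j <= (r + a * k)./2 -> d * k + uphalf (r + a * k) + j <= m ->
      a * (m - d * k - uphalf (r + a * k) - j)
      + (a + d) * (j.*2 + odd (r + a * k))
      + (a + 2 * d) * ((r + a * k)./2 - j) = a * m + d * r.
    move=> j_le j_m; set x1 := m - _ - _ - _; set x3 := _ - j; set x2 := _.*2 + _.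
    have eq_t : x2 + 2 * x3 = r + a * k by rewrite /x2 /x3; lia.
    have -> : m = x1 + x2 + x3 + d * k by rewrite /x1 /x2 /x3; lia.
    have -> : a * (x1 + x2 + x3 + d * k) + d * r
        = a * (x1 + x2 + x3) + d * (r + a * k) by ring.
    by rewrite -eq_t; ring.
  by case: (leqP i) => ir; apply: E; move: m_ge; case: ifP; lia.
Qed.

(** Modulo [a], [n] is [d * t] with [t = x2 + 2 * x3]; cancelling [d] gives [t = r] modulo [a], and
    [k] is the quotient of [t] by [a]. *)
Lemma representation_level (a d n r : nat) (x : nat * nat * nat) :
    r < a -> coprime a d -> n = d * r %[mod a] ->
    representations a (a + d) (a + 2 * d) n x ->
  exists k, x.1.2 + 2 * x.2 = r + a * k /\
    n = a * (x.1.1 + x.1.2 + x.2 + d * k) + d * r.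
Proof.
move=> r_lt co_ad n_mod xn; set t := x.1.2 + 2 * x.2.
have n_st : n = a * (x.1.1 + x.1.2 + x.2) + d * t by rewrite -xn /t; ring.
have t_mod : t %% a = r.
  rewrite -(modn_small r_lt); apply: (eqn_modMl_coprime _ _ _ _ co_ad).
  by rewrite -n_mod n_st [a * _]mulnC modnMDl.
exists (t %/ a); rewrite mulnC addnC -t_mod -divn_eq; split=> //.
by rewrite n_st {1}(divn_eq t a) t_mod; ring.
Qed.

(** With [t = x2 + 2 * x3] and [i = x2./2], one has [x2 + x3 = uphalf t + i], so an upper bound on
    [m] bounds [i]. *)
Lemma representation_below_threshold
    (a d p n r : nat) (x : nat * nat * nat) :
    0 < a -> r < a -> p <= a %/ 2 -> coprime a d ->
    n = d * r %[mod a] -> n < threshold a d p r ->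
    representations a (a + d) (a + 2 * d) n x ->
  (x.1.2 + 2 * x.2 = r /\ x.1.2./2 < p) \/
  (x.1.2 + 2 * x.2 = r + a /\ r./2.+1 + x.1.2./2 < p).
Proof.
move=> a_gt0 r_lt p_le co_ad n_mod n_lt xn.
have [k [eq_t eq_n]] := representation_level a d n r x r_lt co_ad n_mod xn.
move: n_lt; rewrite eq_n /threshold ltn_add2r ltn_pmul2l // /level.
case: x eq_t {xn eq_n} => [[x1 x2] x3] /=.
case: k => [|[|k]]; rewrite ?muln0 ?muln1.
- by case: ifP; lia.
- by case: ifP; lia.
(* For [k >= 2], [t <= 2 * s] gives [m >= uphalf r + a + 2 * d], which is not below [level] because
   [p <= a %/ 2]. *)
- by rewrite !mulnS; move: (a * k) (d * k) => ak dk; case: ifP; lia.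
Qed.

Lemma denumerant_below_threshold (a d p n r : nat) :
  0 < a -> r < a -> p <= a %/ 2 -> coprime a d ->
  n = d * r %[mod a] -> n < threshold a d p r ->
  denumerant a (a + d) (a + 2 * d) n <= p.
Proof.
move=> a_gt0 r_lt p_le co_ad n_mod n_lt.
(* Triples with [k = 1] are numbered after the [r./2.+1] possible values of [x2./2] for [k = 0]. *)
pose g (x : nat * nat * nat) :=
  if x.1.2 + 2 * x.2 == r then x.1.2./2 else r./2.+1 + x.1.2./2.
have tP x := representation_below_threshold
  a d p n r x a_gt0 r_lt p_le co_ad n_mod n_lt.
apply: (@denumerant_leq _ _ _ _ _ g); try lia.
  by move=> x /tP; rewrite /g; case: eqP; lia.
move=> [[x1 x2] x3] [[y1 y2] y3] xn yn eq_g.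
have [eq2 eq3] : x2 = y2 /\ x3 = y3.
  by move: (tP _ xn) (tP _ yn) eq_g; rewrite /g /=; do 2 case: eqP; lia.
move: xn yn; rewrite /representations /= -eq2 -eq3 => <- /eqP.
by rewrite !eqn_add2r eqn_pmul2l // => /eqP ->.
Qed.

Lemma sparse_setE (a d p n r : nat) :
  0 < a -> r < a -> p <= a %/ 2 -> coprime a d -> n = d * r %[mod a] ->
  (denumerant a (a + d) (a + 2 * d) n <= p) = (n < threshold a d p r).
Proof.
move=> a_gt0 r_lt p_le co_ad n_mod.
apply/idP/idP; last exact: denumerant_below_threshold.
apply: contraLR; rewrite -leqNgt -ltnNge => n_ge.
(* Lying in the class of the threshold, [n] is obtained from it by raising [m] by some [q]. *)
have /dvdnP[q eq_q] : a %| n - threshold a d p r.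
  by rewrite -eqn_mod_dvd // n_mod threshold_mod.
rewrite -(subnK n_ge) eq_q /threshold addnA [q * a]mulnC -mulnDr.
by apply: denumerant_above_threshold => //; apply: leq_addl.
Qed.

(** * Sums of levels and thresholds *)

Lemma sum_modn_mul (a d : nat) (F : nat -> nat) : 0 < a -> coprime a d ->
  \sum_(c < a) F c = \sum_(r < a) F ((d * r) %% a).
Proof.
move=> a_gt0 co_ad.
by rewrite (reindex_inj (modn_mul_inj a d a_gt0 co_ad)).
Qed.

Lemma sum_nat_blocks (a Q : nat) (F : nat -> nat) :
  \sum_(0 <= n < a * Q) F n = \sum_(c < a) \sum_(0 <= q < Q) F (q * a + c).
Proof.
rewrite exchange_big /=; elim: Q => [|Q IHQ]; first by rewrite muln0 !big_geq.
rewrite big_nat_recr //= -IHQ mulnS addnC (@big_cat_nat _ _ _ (a * Q)) ?leq_addr //=.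
congr (_ + _); rewrite -{1}[a * Q]add0n big_addn addKn big_mkord.
by apply: eq_bigr => c _; rewrite addnC mulnC.
Qed.

Lemma sum_nat_ltn (Q k : nat) : k <= Q -> \sum_(0 <= q < Q) (q < k) = k.
Proof.
move=> le_kQ; rewrite (@big_cat_nat _ _ _ k) //=.
rewrite [X in _ + X]big_nat_cond [X in _ + X]big1 => [|q]; last first.
  by rewrite andbT => /andP[kq _]; rewrite ltnNge kq.
rewrite (@eq_big_nat _ _ _ 0 k _ (fun=> 1)) => [|q /andP[_ ->] //].
by rewrite sum_nat_const_nat subn0 muln1 addn0.
Qed.

Lemma sum_uphalf (a : nat) : 4 * \sum_(r < a) uphalf r + odd a = a * a.
Proof.
elim: a => [|a]; first by rewrite big_ord0.
rewrite big_ord_recr oddS mulnS mulSn /=; set S := \sum_(_ < _) _; lia.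
Qed.

(** For [r < 2 * p] the summand is the excess of [level a d p r] over [uphalf r + p], because
    [uphalf r + r./2 = r]. *)
Lemma sum_level_excess (a d p : nat) : 0 < d -> p <= a %/ 2 ->
  \sum_(0 <= r < 2 * p) (d + uphalf (r + a) - r.+1) + p * p + p
    = p * (a + 2 * d).
Proof.
move=> d_gt0; elim: p => [|p IHp] p_le; first by rewrite big_geq.
(* The terms for [2 * p] and [2 * p + 1] are taken together: they add up to
   [a + 2 * d - 2 * (p + 1)] whatever the parity of [a]. *)
have -> : 2 * p.+1 = (2 * p).+2 by lia.
rewrite !big_nat_recr //=; have := IHp (ltnW p_le); nia.
Qed.

Lemma sum_level (a d p : nat) : 0 < d -> p <= a %/ 2 ->
  4 * \sum_(r < a) level a d p r + odd a + 4 * p * p + 4 * p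
    = a * a + 4 * a * p + 4 * p * (a + 2 * d).
Proof.
move=> d_gt0 p_le.
have -> : \sum_(r < a) level a d p r
    = \sum_(r < a) (uphalf r + p)
      + \sum_(0 <= r < 2 * p) (d + uphalf (r + a) - r.+1).
  have split_sum (F : nat -> nat) : \sum_(r < a) F r
      = \sum_(0 <= r < 2 * p) F r + \sum_(2 * p <= r < a) F r.
    by rewrite -(big_mkord xpredT) (@big_cat_nat _ _ _ (2 * p)) //=; lia.
  rewrite (split_sum (level a d p)) (split_sum (fun r => uphalf r + p)).
  rewrite addnAC -big_split /=; congr (_ + _); apply: eq_big_nat => r;
    rewrite /level; case: ifP; lia.
have := sum_uphalf a; have := sum_level_excess a d p d_gt0 p_le.
by rewrite big_split /= sum_nat_const card_ord; lia.
Qed.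

(** The remainders of the thresholds permute [0, ..., a - 1], so [a] times the sum of quotients is
    the sum of thresholds minus [a * (a - 1) / 2]. Negative terms are moved to the left to stay
    within [nat]. *)
Lemma sum_threshold_div (a d p : nat) :
  0 < a -> 0 < d -> coprime a d -> p <= a %/ 2 ->
  4 * \sum_(r < a) threshold a d p r %/ a + 4 * p * p + 4 * p
    + odd a + 2 * a
  = a * a + 4 * a * p + 4 * p * (a + 2 * d) + 2 * d * (a - 1) + 2.
Proof.
move=> a_gt0 d_gt0 co_ad p_le; have sumL := sum_level a d p d_gt0 p_le.
have sum_id : 2 * \sum_(r < a) r + a = a * a.
  by have := bin2_sum a; rewrite big_mkord bin2; move=> ->; nia.
have sum_div : a * \sum_(r < a) threshold a d p r %/ a + \sum_(r < a) r
    = a * \sum_(r < a) level a d p r + d * \sum_(r < a) r.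
  rewrite [X in _ + X = _](sum_modn_mul a d id) // !big_distrr -!big_split /=.
  apply: eq_bigr => r _; rewrite -/(threshold a d p r).
  rewrite [RHS](divn_eq _ a) mulnC; congr (_ + _).
  exact/esym/threshold_mod.
move: sumL sum_div sum_id; set S := \sum_(r < a) r.
set G := \sum_(r < a) _ %/ a; set L := \sum_(r < a) _ => sumL sum_div sum_id.
have : a * (2 * G + a + d) = a * (2 * L + d * a + 1) by nia.
move/eqP; rewrite eqn_pmul2l // => /eqP.
have : d * (a - 1) + d = d * a by rewrite -mulnSr; congr (_ * _); lia.
by clear sum_div sum_id; rewrite -[2 * d * _]mulnA; set D := d * (a - 1); lia.
Qed.

(** * The [p]-Frobenius number *)

Definition frobenius_value (a d p : nat) : nat :=
  (a + 2 * d) * p + (a - 2) %/ 2 * a + (a - 1) * d.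

Lemma frobenius_valueDa (a d p : nat) : 3 <= a ->
  frobenius_value a d p + a = a * (p + a./2) + d * (a - 1 + 2 * p).
Proof.
move=> a_ge3; rewrite /frobenius_value.
have -> : a./2 = (a - 2) %/ 2 + 1 by lia.
by ring.
Qed.

Lemma threshold_leq (a d p r : nat) : 0 < d -> 3 <= a -> r < a -> p <= a %/ 2 ->
  threshold a d p r <= frobenius_value a d p + a.
Proof.
move=> d_gt0 a_ge3 r_lt p_le.
rewrite frobenius_valueDa // /threshold /level; case: ifP => pr.
  by apply: leq_add; rewrite leq_mul2l; apply/orP; right; lia.
have level_le : d + uphalf (r + a) + p - r./2.+1 <= d + (p + a./2) by lia.
(* Here [r <= 2 * p - 1]; the summand [d] of the level bound supplies the missing [a * d]. *)
have r_le : d * r + d <= d * (2 * p) by rewrite -mulnSr leq_mul2l; lia.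
have := leq_mul (leqnn a) level_le; nia.
Qed.

Lemma threshold_max (a d p : nat) : 0 < d -> 3 <= a -> p <= a %/ 2 ->
  exists2 r, r < a & threshold a d p r = frobenius_value a d p + a.
Proof.
move=> d_gt0 a_ge3 p_le.
(* [2 * p - 1] is the largest [r] in the second branch of [level], the one that gains [a * d]; for
   [p = 0] that branch is empty and the largest [r] wins. *)
exists (if p is p'.+1 then p'.*2.+1 else a.-1); first by case: p p_le; lia.
rewrite frobenius_valueDa // /threshold /level; case: p p_le => [|p] p_le.
  rewrite leq0n; have -> : uphalf a.-1 = a./2 by lia.
  by rewrite !addn0 subn1.
have -> : (p < p.*2.+1./2) = false by lia.
have -> : d + uphalf (p.*2.+1 + a) + p.+1 - p.*2.+1./2.+1 = d + (p.+1 + a./2) by lia.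
by rewrite -muln2; nia.
Qed.

Lemma sparse_leq_frobenius (a d p n : nat) :
  0 < d -> 3 <= a -> coprime a d -> p <= a %/ 2 ->
  denumerant a (a + d) (a + 2 * d) n <= p -> n <= frobenius_value a d p.
Proof.
move=> d_gt0 a_ge3 co_ad p_le; have a_gt0 : 0 < a by lia.
have [r r_lt n_mod] := modn_mul_surj a d n a_gt0 co_ad.
rewrite (sparse_setE a d p n r) // => n_lt.
(* A number below the threshold in the same class is below it by at least [a]. *)
have /dvdn_leq : a %| threshold a d p r - n.
  by rewrite -eqn_mod_dvd ?(ltnW n_lt) // n_mod threshold_mod.
have := threshold_leq a d p r d_gt0 a_ge3 r_lt p_le; lia.
Qed.

Lemma sparse_frobenius (a d p : nat) :
  0 < d -> 3 <= a -> coprime a d -> p <= a %/ 2 ->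
  denumerant a (a + d) (a + 2 * d) (frobenius_value a d p) <= p.
Proof.
move=> d_gt0 a_ge3 co_ad p_le; have a_gt0 : 0 < a by lia.
have [r r_lt eq_g] := threshold_max a d p d_gt0 a_ge3 p_le.
rewrite (sparse_setE a d p _ r) ?eq_g //; first lia.
by rewrite -modnDr -eq_g threshold_mod.
Qed.

(** * The [p]-genus *)

Lemma count_sparse (a d p Q : nat) :
  0 < a -> coprime a d -> p <= a %/ 2 ->
  (forall r, r < a -> threshold a d p r %/ a <= Q) ->
  \sum_(0 <= n < a * Q) (denumerant a (a + d) (a + 2 * d) n <= p)
    = \sum_(r < a) threshold a d p r %/ a.
Proof.
move=> a_gt0 co_ad p_le Q_ge; rewrite sum_nat_blocks.
rewrite (sum_modn_mul a d (fun c => \sum_(0 <= q < Q)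
  (denumerant a (a + d) (a + 2 * d) (q * a + c) <= p))) //.
apply: eq_bigr => r _; rewrite -[RHS](@sum_nat_ltn Q) ?Q_ge //.
apply: eq_bigr => q _; rewrite (sparse_setE a d p _ r) ?modnMDl ?modn_mod //.
(* Both sides have the same remainder modulo [a], so only the quotients are compared. *)
rewrite {1}(divn_eq (threshold a d p r) a) threshold_mod ltn_add2r.
by rewrite ltn_pmul2r.
Qed.

Theorem theorem1 (a d p : nat) (a_ge3 : (3 <= a)%N) (d_gt0 : (0 < d)%N)
    (coprime_ad : gcdn a d = 1%N) (p_le : (p <= a %/ 2)%N) :
  [/\ finite_set (sparse_set p a (a + d) (a + 2 * d)),
      p_frobenius p a (a + d) (a + 2 * d)
        = ((a + 2 * d) * p + (a - 2) %/ 2 * a + (a - 1) * d)%N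
    & ((p_genus p a (a + d) (a + 2 * d))%:R : rat)
        = (if odd a then
             (2 * a%:R + 2 * d%:R - 1 - p%:R) * p%:R
               + (a%:R - 1) * (a%:R + 2 * d%:R - 1) / 4
           else
             (2 * a%:R + 2 * d%:R - 1 - p%:R) * p%:R
               + ((a%:R - 1) * (a%:R + 2 * d%:R - 1) + 1) / 4)%R].
Proof.
have co_ad : coprime a d by apply/eqP.
have a_gt0 : 0 < a by lia.
have sparse_le n := sparse_leq_frobenius a d p n d_gt0 a_ge3 co_ad p_le.
have fin : finite_set (sparse_set p a (a + d) (a + 2 * d)).
  apply: (@sub_finite_set _ _ `I_(frobenius_value a d p).+1).
    by move=> n /sparse_le; rewrite /= ltnS.
  exact: finite_II.
split=> //.
  rewrite -/(frobenius_value a d p); apply/eqP; rewrite eqn_leq; apply/andP; split.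
    by apply/bigmax_leqP_seq => n; rewrite in_fset_set // inE => /sparse_le.
  apply: (@leq_bigmax_seq _ _ xpredT id) => //.
  by rewrite in_fset_set // inE; apply: sparse_frobenius.
have genusE : p_genus p a (a + d) (a + 2 * d)
    = \sum_(r < a) threshold a d p r %/ a.
  rewrite -(count_sparse a d p (frobenius_value a d p).+1) //; last first.
    (* The cutoff suffices: with [g] the Frobenius value, the quotient is at most [g %/ a + 1]. *)
    move=> r r_lt; have := threshold_leq a d p r d_gt0 a_ge3 r_lt p_le.
    move/(leq_div2r a)/leq_trans; apply.
    by rewrite divnDr // divnn a_gt0 addn1 ltnS leq_div.
  set D := denumerant _ _ _; set B := index_iota _ _.
  transitivity (size [seq n <- B | D n <= p]).
    apply/perm_size/uniq_perm; rewrite ?fset_uniq ?filter_uniq ?iota_uniq // => n.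
    rewrite in_fset_set // mem_filter mem_index_iota.
    apply/idP/and3P => [|[Dn _ _]]; rewrite inE //= => Dn; split=> //.
    exact: leq_trans (sparse_le n Dn : n < _.+1) (leq_pmull _ a_gt0).
  by rewrite size_filter -sum1_count big_mkcond; apply: eq_bigr => n _; case: leqP.
have := sum_threshold_div a d p a_gt0 d_gt0 co_ad p_le; rewrite -genusE.
set G := p_genus _ _ _ _.
(* In [rat] the term [a - 1] becomes a true difference since [a >= 1], and the identity is linear in
   [G] for each parity of [a]. *)
move/(congr1 (fun n => n%:R : rat)%R); rewrite !(GRing.natrD, GRing.natrM) GRing.natrB //.
by case: (odd a) => /= eqG; lra.
Qed.
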